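(* Let $\Omega$ be a compact Hausdorff space and let $X$ be a real Banach space such that every unit vector of $X$ that is a very smooth point of $X$ is a $QP$-point of $X$. Then every unit vector of $C(\Omega,X)$ that is a very smooth point of $C(\Omega,X)$ is a $QP$-point of $C(\Omega,X)$.
   Context: $C(\Omega,X)$ is the Banach space of $X$-valued continuous functions on $\Omega$ with the supremum norm. For a Banach space $Z$, a non-zero $z \in Z$ is a smooth point of $Z$ if there is a unique norm-one $z_0^\ast \in Z^\ast$ with $z_0^\ast(z) = \|z\|$; a smooth point $z$ of $Z$ is very smooth if it is also a smooth point of $Z^{\ast\ast}$ (with $Z$ canonically embedded in $Z^{\ast\ast}$). $Z_1$ is the closed unit ball of $Z$. For a unit vector $z \in Z$ put $S_z = \{z^\ast \in Z^\ast_1 : z^\ast(z) = 1\}$. A unit vector $x \in Z$ is a $QP$-point (quasi-polyhedral point) of $Z$ if there is $\delta > 0$ such that $S_z \subset S_x$ for every unit vector $z \in Z$ with $\|z-x\|<\delta$. *)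

(* Defs.v *)
From HB Require Import structures.
From mathcomp Require Import all_boot all_order all_algebra.
From mathcomp Require Import all_classical all_reals all_analysis.
From mathcomp Require Import ring.

Set Implicit Arguments.
Unset Strict Implicit.
Unset Printing Implicit Defensive.

Import Order.TTheory GRing.Theory Num.Theory.
Import numFieldNormedType.Exports.

Local Open Scope classical_set_scope.
Local Open Scope ring_scope.

(* As [sup] of an empty or unbounded set is 0, [sup_norm A f] is meaningful only
   when [f] is bounded on [A]; it is used only in that situation, and the
   value 0 is the right one when [A] is empty. *)
Definition sup_norm {R : realType} {T : Type} {V : normedModType R}
  (A : set T) (f : T -> V) : R := sup [set `|f x| | x in A].

Section sup_norm_theory.
Context {R : realType} {T : Type} {V : normedModType R} (A : set T).
Implicit Types f g : T -> V.

Definition bounded_on f := exists M : R, forall x, A x -> `|f x| <= M.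

Lemma sup_norm_ge f x : bounded_on f -> A x -> `|f x| <= sup_norm A f.
Proof.
move=> [M fM] Ax; apply: ub_le_sup; last by exists x.
by exists M => _ [y Ay <-]; exact: fM.
Qed.

Lemma sup_norm_ge0 f : 0 <= sup_norm A f.
Proof.
rewrite /sup_norm; have [[[_ [x Ax _]] ub]|/sup_out->//] := pselect (has_sup [set `|f x| | x in A]).
by rewrite (le_trans (normr_ge0 (f x)))//; apply: ub_le_sup => //; exists x.
Qed.

Lemma sup_norm_le f (M : R) : 0 <= M -> (forall x, A x -> `|f x| <= M) ->
  sup_norm A f <= M.
Proof.
move=> M0 fM; have [->|/set0P A0] := eqVneq A set0.
  by rewrite /sup_norm image_set0 sup0.
apply: ge_sup; first by case: A0 => a Aa; exists `|f a|, a.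
by move=> _ [x Ax <-]; exact: fM.
Qed.

Lemma sup_normD f g : bounded_on f -> bounded_on g ->
  sup_norm A (f \+ g) <= sup_norm A f + sup_norm A g.
Proof.
move=> bf bg; apply: sup_norm_le; first by rewrite addr_ge0 ?sup_norm_ge0.
by move=> x Ax; rewrite (le_trans (ler_normD _ _))// lerD ?sup_norm_ge.
Qed.

Lemma sup_normZ (k : R) f : bounded_on f ->
  sup_norm A (k \*: f) = `|k| * sup_norm A f.
Proof.
have le (l : R) h : bounded_on h -> sup_norm A (l \*: h) <= `|l| * sup_norm A h.
  move=> bh; apply: sup_norm_le => [|x Ax]; first by rewrite mulr_ge0 ?sup_norm_ge0.
  by rewrite /= normrZ ler_wpM2l ?sup_norm_ge.
move=> bf; have [->|k0] := eqVneq k 0.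
  apply/eqP; rewrite normr0 mul0r eq_le sup_norm_ge0 andbT.
  by apply: sup_norm_le => // x _ /=; rewrite scale0r normr0.
apply/eqP; rewrite eq_le le//= -ler_pdivlMl ?normr_gt0// -normfV.
have {1}-> : f = k^-1 \*: (k \*: f).
  by apply/funext => x /=; rewrite scalerA mulVf// scale1r.
apply: le; case: bf => M fM; exists (`|k| * M) => x Ax /=.
by rewrite normrZ ler_wpM2l ?fM.
Qed.

Lemma sup_norm_eq0 f : bounded_on f -> sup_norm A f = 0 ->
  forall x, A x -> f x = 0.
Proof.
by move=> bf f0 x Ax; apply/eqP; rewrite -normr_le0 -f0 sup_norm_ge.
Qed.

End sup_norm_theory.

Definition lincont {R : realType} (Z : normedModType R) : {pred Z -> R^o} :=
  mem [set f : Z -> R^o | linear f /\ continuous f].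
Arguments lincont {R} Z.

(* The dual space Z^*, with the operator norm *)
Record dual {R : realType} (Z : normedModType R) := Dual {
  dual_fun :> Z -> R^o ;
  dual_funP : dual_fun \in lincont Z }.

Section dual_theory.
Context {R : realType} (Z : normedModType R).
Implicit Types f g : dual Z.

HB.instance Definition _ := [isSub for @dual_fun R Z].
HB.instance Definition _ := [Choice of dual Z by <:].

Lemma dual_linear f : linear f.
Proof. by have := dual_funP f; rewrite inE => -[]. Qed.

Lemma dual_continuous f : continuous f.
Proof. by have := dual_funP f; rewrite inE => -[]. Qed.

HB.instance Definition _ f :=
  GRing.isLinear.Build R Z R^o *:%R f (@dual_linear f).

Lemma lincont_submod_closed : submod_closed (lincont Z).
Proof.
split.
  rewrite inE; split=> [k x y|]; first by rewrite /= scaler0 addr0.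
  exact: cst_continuous.
move=> k f g; rewrite !inE => -[lf cf] [lg cg]; split.
  move=> a x y; rewrite !fctE lf lg !scalerDr !scalerA (mulrC k a).
  by rewrite addrACA.
by move=> x; apply: continuousD; [exact/continuousZl_tmp/cf|exact: cg].
Qed.

HB.instance Definition _ := GRing.isSubmodClosed.Build _ _ (lincont Z)
  lincont_submod_closed.
HB.instance Definition _ := [SubChoice_isSubLmodule of dual Z by <:].

Definition dual_norm f : R := sup_norm [set x : Z | `|x| <= 1] f.

Lemma dual_bounded f : bounded_on [set x : Z | `|x| <= 1] f.
Proof.
have /linear_bounded_continuous/bounded_funP/(_ 1)[M fM] := @dual_continuous f.
by exists M.
Qed.

Let dual_normD f g : dual_norm (f + g) <= dual_norm f + dual_norm g.
Proof. by apply: sup_normD; exact: dual_bounded. Qed.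

Let dual_normZ (k : R) f : dual_norm (k *: f) = `|k| * dual_norm f.
Proof. by apply: sup_normZ; exact: dual_bounded. Qed.

Let dual_norm0_eq0 f : dual_norm f = 0 -> f = 0.
Proof.
move=> f0; apply/val_inj/funext => x /=.
have [->|x0] := eqVneq x 0; first exact: linear0.
have nx0 : `|x| != 0 by rewrite normr_eq0.
have : f (`|x|^-1 *: x) = 0.
  apply: sup_norm_eq0 f0 _ _; first exact: dual_bounded.
  by rewrite /= normrZ normfV normr_id mulVf.
by rewrite linearZ => /eqP; rewrite scaler_eq0 invr_eq0 (negbTE nx0) => /eqP.
Qed.

HB.instance Definition _ := Lmodule_isNormed.Build R (dual Z)
  dual_normD dual_normZ dual_norm0_eq0.

Lemma dual_normE f : `|f| = sup [set `|f x| | x in [set x : Z | `|x| <= 1]].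
Proof. by []. Qed.

Lemma dual_le f x : `|f x| <= `|f| * `|x|.
Proof.
have [->|x0] := eqVneq x 0; first by rewrite linear0 !normr0 mulr0.
have nx0 : 0 < `|x| by rewrite normr_gt0.
have : `|f (`|x|^-1 *: x)| <= `|f|.
  apply: sup_norm_ge; first exact: dual_bounded.
  by rewrite /= normrZ normfV normr_id mulVf ?gt_eqF.
by rewrite linearZ normrZ normfV normr_id ler_pdivrMl// mulrC.
Qed.

End dual_theory.

Section canonical_embedding.
Context {R : realType} (Z : normedModType R).

Lemma eval_lincont (z : Z) : (fun f : dual Z => f z) \in lincont (dual Z).
Proof.
have evl : linear (fun f : dual Z => f z) by [].
pose ev : {linear dual Z -> R^o} :=
  HB.pack (fun f : dual Z => f z)
    (GRing.isLinear.Build R (dual Z) R^o *:%R (fun f : dual Z => f z) evl).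
rewrite inE; split=> //.
apply: (@bounded_linear_continuous _ _ _ ev); apply/bounded_funP => r.
exists (r * `|z|) => f fr; rewrite (le_trans (dual_le _ _))//.
by rewrite ler_wpM2r.
Qed.

(* The canonical embedding Z -> Z^** *)
Definition bidual_embedding (z : Z) : dual (dual Z) := Dual (eval_lincont z).

End canonical_embedding.

Section smoothness.
Context {R : realType} {Z : normedModType R}.
Implicit Types x z : Z.

Definition smooth_point z : Prop :=
  z != 0 /\ exists! f : dual Z, `|f| = 1 /\ f z = `|z|.

(* The set S_z; meaningful for unit vectors [z] *)
Definition state_set z : set (dual Z) :=
  [set f : dual Z | `|f| <= 1 /\ f z = 1].

Definition QP_point x : Prop :=
  `|x| = 1 /\ exists2 delta : R, 0 < delta &
    forall z, `|z| = 1 -> `|z - x| < delta -> state_set z `<=` state_set x.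

End smoothness.

Definition very_smooth_point {R : realType} {Z : normedModType R} (z : Z) :
  Prop := smooth_point z /\ smooth_point (bidual_embedding z).

Section continuousType_lmodule.
Context {R : realType} (Omega : topologicalType) (X : normedModType R).

Definition cts : {pred Omega -> X} := mem [set f : Omega -> X | continuous f].

Definition cts_Sub (f : Omega -> X) (fc : f \in cts) : continuousType Omega X :=
  [the continuousType Omega X of mkcts (set_mem fc)].

Lemma cts_rect (K : continuousType Omega X -> Type) :
  (forall f (fc : f \in cts), K (cts_Sub fc)) -> forall u, K u.
Proof.
move=> Ksub u; have uc : (u : Omega -> X) \in cts.
  by rewrite inE; exact: cts_fun.
by have -> : u = cts_Sub uc by exact/continuousEP.
Qed.

Lemma cts_valP f (fc : f \in cts) : cts_Sub fc = f :> (Omega -> X).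
Proof. by []. Qed.

HB.instance Definition _ :=
  isSub.Build _ _ (continuousType Omega X) cts_rect cts_valP.

Lemma cts_submod_closed : submod_closed cts.
Proof.
split; first by rewrite inE; exact: cst_continuous.
move=> k f g; rewrite !inE => cf cg x.
by apply: continuousD; [exact/continuousZl_tmp/cf|exact: cg].
Qed.

HB.instance Definition _ := GRing.isSubmodClosed.Build _ _ cts
  cts_submod_closed.
HB.instance Definition _ :=
  [SubChoice_isSubLmodule of continuousType Omega X by <:].

End continuousType_lmodule.

(* C(Omega, X) with the supremum norm. The compactness proof is a parameter so
   that the norm (a finite supremum) can be attached to the type. *)
Definition cont_space {R : realType} {Omega : topologicalType}
  (cO : compact [set: Omega]) (X : normedModType R) := continuousType Omega X.

Section cont_space_normed.
Context {R : realType} {Omega : topologicalType} (cO : compact [set: Omega]).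
Context (X : normedModType R).
Implicit Types f g : cont_space cO X.

HB.instance Definition _ := GRing.Lmodule.copy (cont_space cO X)
  (continuousType Omega X).

Lemma cont_space_bounded f : bounded_on [set: Omega] f.
Proof.
have cf : {within [set: Omega], continuous f}.
  by apply: continuous_subspaceT; exact: cts_fun.
have [M [_ fM]] := compact_bounded (continuous_compact cf cO).
by exists (M + 1) => x _; apply: (fM (M + 1)); [rewrite ltrDl|exists x].
Qed.

Definition cont_space_norm f : R := sup_norm [set: Omega] f.

Let cont_space_normD f g :
  cont_space_norm (f + g) <= cont_space_norm f + cont_space_norm g.
Proof. by apply: sup_normD; exact: cont_space_bounded. Qed.

Let cont_space_normZ (k : R) f :
  cont_space_norm (k *: f) = `|k| * cont_space_norm f.
Proof. by apply: sup_normZ; exact: cont_space_bounded. Qed.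

Let cont_space_norm0_eq0 f : cont_space_norm f = 0 -> f = 0.
Proof.
move=> f0; apply/val_inj/funext => x /=.
by apply: sup_norm_eq0 f0 _ _ => //; exact: cont_space_bounded.
Qed.

HB.instance Definition _ := Lmodule_isNormed.Build R (cont_space cO X)
  cont_space_normD cont_space_normZ cont_space_norm0_eq0.

Lemma cont_space_normE f : `|f| = sup [set `|f t| | t in [set: Omega]].
Proof. by []. Qed.

Lemma cont_space_le f t : `|f t| <= `|f|.
Proof. by apply: sup_norm_ge => //; exact: cont_space_bounded. Qed.

End cont_space_normed.

Section cont_space_complete.
Context {R : realType} {Omega : topologicalType} (cO : compact [set: Omega]).
Context (X : completeNormedModType R).

Let cont_space_cauchy_cvg (F : set_system (cont_space cO X)) :
  ProperFilter F -> cauchy F -> cvg F.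
Proof.
move=> FF /cauchy_ballP Fc.
have cauchyF e : 0 < e -> \forall f & h \near F, `|f - h| < e.
  by move=> e0; have := Fc _ e0; rewrite -ball_normE.
have cvgt t : cvg ((fun f : cont_space cO X => f t) @ F).
  apply/cauchy_cvgP/cauchy_ballP => e e0; rewrite -ball_normE.
  have := cauchyF _ e0; rewrite !near_simpl => -[[P Q] [FP FQ] PQ].
  exists ((fun f : cont_space cO X => f t) @` P,
          (fun f : cont_space cO X => f t) @` Q) => /=.
    by split => /=; [apply: filterS FP|apply: filterS FQ] => f ?; exists f.
  move=> [_ _] /= [[f Pf <-] [h Qh <-]] /=.
  apply: le_lt_trans (PQ (f, h) (conj Pf Qh)) => /=.
  exact: (cont_space_le (f - h) t).
pose g t : X := lim ((fun f : cont_space cO X => f t) @ F).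
have unif e : 0 < e -> \forall f \near F, forall t, `|g t - (f : cont_space cO X) t| <= e.
  move=> e0; have e20 : 0 < e / 2 by rewrite divr_gt0.
  have := cauchyF _ e20; rewrite !near_simpl => -[[P Q] [FP FQ] PQ].
  apply: filterS FP => f Pf t.
  have /cvgrPdist_lt/(_ _ e20) gt := cvgt t.
  have [h [Qh gh]] := filter_ex (filterI FQ gt).
  rewrite -(subrK (h t) (g t)) -addrA (le_trans (ler_normD _ _))//.
  rewrite (splitr e) lerD//; first exact: ltW.
  rewrite distrC (le_trans (cont_space_le (f - h) t))//.
  exact/ltW/(PQ (f, h) (conj Pf Qh)).
have gc : continuous g.
  move=> t; apply/cvgrPdist_le => e e0.
  have e30 : 0 < e / 3 by rewrite divr_gt0.
  have [f fg] := filter_ex (unif _ e30).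
  have /cvgrPdist_le/(_ _ e30) ft := @cts_fun _ _ f t.
  apply: filterS ft => s fts.
  have -> : g t - g s = (g t - f t) + (f t - f s) + (f s - g s).
    by rewrite !addrA !subrK.
  rewrite (le_trans (ler_normD _ _))// (le_trans (lerD (ler_normD _ _) (lexx _)))//.
  have -> : e = e / 3 + e / 3 + e / 3 by field.
  by rewrite !lerD// distrC.
pose G : cont_space cO X := cts_Sub (mem_set gc).
apply/cvg_ex; exists G; apply/cvgrPdist_le => e e0.
apply: filterS (unif _ e0) => f gf.
by apply: sup_norm_le => [|t _]; [exact: ltW|exact: gf].
Qed.

HB.instance Definition _ := Uniform_isComplete.Build (cont_space cO X)
  cont_space_cauchy_cvg.

End cont_space_complete.

(* Main.v *)
(* A unit vector f of C(Omega, X) that is smooth peaks at a single point t,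
   since every point where |f| is 1 carries a norming functional. If f is very
   smooth then t is isolated: otherwise an ultrafilter limit, as s -> t with
   s <> t, of functionals supported at s and norming f(s) would be a second
   element of the third dual norming f, separated from the one at t by the
   bidual element "value of the measure on {t}" (an ultrafilter limit of bump
   functions shrinking to t). Hence C(Omega, X) is the l^oo-sum of X and
   C(Omega \ {t}, X), so f(t) is very smooth in X, therefore a QP-point, and
   |f| <= r < 1 off t. For z close to f, a state at z only sees z(t), so the
   QP-property of f(t) passes to f. *)

Require Import Defs.
From HB Require Import structures.
From mathcomp Require Import all_boot all_order all_algebra.
From mathcomp Require Import all_classical all_reals all_analysis.
From mathcomp Require Import lra.

Import Order.TTheory GRing.Theory Num.Theory.
Import numFieldNormedType.Exports.

Local Open Scope classical_set_scope.
Local Open Scope ring_scope.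

(** * Hahn-Banach theorem through minimal sublinear functionals *)

Section hahn_banach.
Context {R : realType} {Z : normedModType R}.
Implicit Types (p q : Z -> R) (x y z : Z).

(** Homogeneity is asked as an inequality only; the reverse one follows by applying it to [t^-1]. *)
Definition sublinear q := (forall x y, q (x + y) <= q x + q y) /\
  (forall t x, 0 < t -> q (t *: x) <= t * q x).

Lemma sublinear0 {q} : sublinear q -> q 0 = 0.
Proof.
(* Subadditivity gives [0 <= q 0], homogeneity at [2^-1] gives [q 0 <= 0]. *)
move=> [qD qZ]; have := qD 0 0; have := qZ 2^-1 0; rewrite scaler0 addr0.
by move=> /(_ _); lra.
Qed.

Lemma sublinearN {q} x : sublinear q -> - q (- x) <= q x.
Proof.
by move=> qs; have := qs.1 x (- x); rewrite subrr sublinear0//; lra.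
Qed.

Lemma sublinearZ_ge {q} t x : sublinear q -> 0 <= t -> t * q x <= q (t *: x).
Proof.
move=> qs; rewrite le_eqVlt => /predU1P[<-|t0].
  by rewrite mul0r scale0r sublinear0.
rewrite -ler_pdivlMl//; have := qs.2 t^-1 (t *: x).
by rewrite scalerA mulVf ?gt_eqF// scale1r invr_gt0 => ->.
Qed.

Lemma sublinear_norm : sublinear (fun x => `|x|).
Proof.
split=> [x y|t x t0]; first exact: ler_normD.
by rewrite normrZ gtr0_norm.
Qed.

(** Serves both for tilts and for lower bounds of chains, which are pointwise infima. *)
Lemma sublinear_inf (A : Z -> set R) :
  (forall x, A x !=set0) -> (forall x, has_lbound (A x)) ->
  (forall x y a b, A x a -> A y b -> exists2 c, A (x + y) c & c <= a + b) ->
  (forall t x a, 0 < t -> A x a -> exists2 c, A (t *: x) c & c <= t * a) ->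
  sublinear (fun x => inf (A x)).
Proof.
move=> A0 Alb AD AZ; split=> [x y|t x t0].
  rewrite -lerBlDr; apply: lb_le_inf => // a Axa.
  rewrite lerBlDr -lerBlDl; apply: lb_le_inf => // b Ayb.
  have [c Ac cab] := AD _ _ _ _ Axa Ayb.
  by rewrite lerBlDl (le_trans _ cab)//; exact: ge_inf.
rewrite -ler_pdivrMl//; apply: lb_le_inf => // a Axa.
have [c Ac ca] := AZ _ _ _ t0 Axa.
by rewrite ler_pdivrMl// (le_trans _ ca)//; exact: ge_inf.
Qed.

(* The largest sublinear functional below [q] taking at most the value
   [- q y] at [- y]: a minimal [q] coincides with all its tilts, which makes it
   additive. *)
Definition tilt q y x := inf [set q (x + t *: y) - t * q y | t in [set t | 0 <= t]].

Section tilt_theory.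
Context {q : Z -> R} (qs : sublinear q).

Let tilt_lbound y x :
  has_lbound [set q (x + t *: y) - t * q y | t in [set t | 0 <= t]].
Proof.
exists (- q (- x)) => _ [t /= t0 <-].
have := qs.1 (x + t *: y) (- x); rewrite (addrC x) addrK.
by have := sublinearZ_ge t y qs t0; lra.
Qed.

Lemma tilt_le_at t y x : 0 <= t -> tilt q y x <= q (x + t *: y) - t * q y.
Proof. by move=> t0; apply: ge_inf => //; exists t. Qed.

Lemma tilt_le y x : tilt q y x <= q x.
Proof.
by have := @tilt_le_at 0 y x (lexx _); rewrite scale0r addr0 mul0r subr0.
Qed.

Lemma tilt_le1 y x : tilt q y x <= q (x + y) - q y.
Proof. by have := @tilt_le_at 1 y x ler01; rewrite scale1r mul1r. Qed.

Lemma sublinear_tilt y : sublinear (tilt q y).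
Proof.
apply: sublinear_inf => // [x|x z _ _ [t /= t0 <-] [s /= s0 <-]|u x _ u0 [t /= t0 <-]].
- by exists (q (x + 0 *: y) - 0 * q y), 0 => /=.
- exists (q (x + z + (t + s) *: y) - (t + s) * q y).
    by exists (t + s) => //=; exact: addr_ge0.
  by rewrite scalerDl addrACA; have := qs.1 (x + t *: y) (z + s *: y); lra.
- exists (q (u *: x + (u * t) *: y) - (u * t) * q y).
    by exists (u * t) => //=; rewrite mulr_ge0// ltW.
  rewrite -scalerA -scalerDr mulrBr mulrA lerD2r.
  exact: qs.2.
Qed.

End tilt_theory.

(** Zorn's lemma for the reversed pointwise order: a non-empty chain is bounded by its pointwise
    infimum, finite because [- p (- x)] lies below all values at [x]. *)
Lemma minimal_sublinear p : sublinear p -> exists2 q, sublinear q &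
  (forall x, q x <= p x) /\
  forall r, sublinear r -> (forall x, r x <= q x) -> r = q.
Proof.
move=> ps; pose T := {q : Z -> R | sublinear q /\ forall x, q x <= p x}.
pose below (q r : T) := `[< forall x, sval r x <= sval q x >].
have [| | | |[q [qs qp]] qmin] := @Zorn T below.
- by move=> q; apply/asboolP.
- move=> q r s /asboolP qr /asboolP rs; apply/asboolP => x.
  exact: le_trans (rs x) (qr x).
- move=> [q Pq] [r Pr] /asboolP/= qr /asboolP/= rq.
  have E : q = r by apply/funext => x; apply/le_anti; rewrite qr rq.
  by case: _ / E Pr {qr rq} => Pr; rewrite (Prop_irrelevance Pq Pr).
(* The infimum of an empty set would be the default value 0, so the empty chain gets the bound [p]
   instead. *)
- move=> A Atot; have [->|/set0P[q0 Aq0]] := eqVneq A set0.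
    by exists (exist _ p (conj ps (fun x => lexx _))).
  pose V x : set R := [set sval q x | q in A].
  have Vlb x : has_lbound (V x).
    exists (- p (- x)) => _ [q _ <-]; have [qs qp] := svalP q.
    by have := qp (- x); have := sublinearN x qs; lra.
  have Vs : sublinear (fun x => inf (V x)).
    apply: sublinear_inf => // [x|x y _ _ [q Aq <-] [r Ar <-]|t x _ t0 [q Aq <-]].
    - by exists (sval q0 x), q0.
    - have [/asboolP h|/asboolP h] := Atot _ _ Aq Ar.
      + exists (sval r (x + y)); first by exists r.
        by have := (svalP r).1.1 x y; have := h x; lra.
      + exists (sval q (x + y)); first by exists q.
        by have := (svalP q).1.1 x y; have := h y; lra.
    - exists (sval q (t *: x)); first by exists q.
      exact: (svalP q).1.2.
  have Vp x : inf (V x) <= p x.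
    by apply: le_trans ((svalP q0).2 x); apply: ge_inf => //; exists q0.
  exists (exist _ (fun x => inf (V x)) (conj Vs Vp) : T) => q Aq; apply/asboolP => x /=.
  by apply: ge_inf => //; exists q.
exists q => //; split=> // r rs rq.
have rp x : r x <= p x by exact: le_trans (rq x) (qp x).
have qr : below (exist _ q (conj qs qp)) (exist _ r (conj rs rp)).
  exact/asboolP.
exact: (congr1 (@sval _ _) (qmin _ qr)).
Qed.

Lemma sublinear_linear p : sublinear p ->
  exists2 g : Z -> R^o, linear g & forall x, g x <= p x.
Proof.
move=> /minimal_sublinear[q qs [qp qmin]].
have qD x y : q (x + y) = q x + q y.
  apply/le_anti; rewrite qs.1/=.
  have := tilt_le1 qs y x.
  by rewrite (qmin _ (sublinear_tilt qs y) (tilt_le qs y)); lra.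
have qN x : q (- x) = - q x.
  by have := qD x (- x); rewrite subrr sublinear0//; lra.
have qZ t x : 0 < t -> q (t *: x) = t * q x.
  by move=> t0; apply/le_anti; rewrite qs.2//= sublinearZ_ge// ltW.
exists q => // t x y; rewrite qD; congr (_ + _).
have [t0|t0|->] := ltgtP t 0; last by rewrite !scale0r sublinear0.
  by rewrite -{1}(opprK t) scaleNr qN qZ ?oppr_gt0// mulNr opprK.
exact: qZ.
Qed.

Lemma bounded_linear_dual {g : Z -> R^o} {M : R} : linear g -> 0 <= M ->
  (forall x, `|g x| <= M * `|x|) ->
  exists2 f : dual Z, `|f| <= M & f = g :> (Z -> R^o).
Proof.
move=> gl M0 gM.
pose G : {linear Z -> R^o} :=
  HB.pack g (GRing.isLinear.Build R Z R^o *:%R g gl).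
have gc : g \in lincont Z.
  rewrite inE; split=> //.
  apply: (@bounded_linear_continuous _ _ _ G); apply/bounded_funP => r.
  by exists (M * r) => x xr; rewrite (le_trans (gM x))// ler_wpM2l.
exists (Dual gc) => //; apply: sup_norm_le => // x /= x1.
by rewrite (le_trans (gM x))// ler_piMr.
Qed.

(** The tilt of the norm at [z] is at most [- |z|] at [- z], so a linear functional below it reaches
    [|z|] at [z]. *)
Lemma norming_functional z : exists2 f : dual Z, `|f| <= 1 & f z = `|z|.
Proof.
have ns := sublinear_norm.
have [g gl gp] := sublinear_linear _ (sublinear_tilt ns z).
pose G : {linear Z -> R^o} :=
  HB.pack g (GRing.isLinear.Build R Z R^o *:%R g gl).
have gN x : g (- x) = - g x by exact: (linearN G).
have gn x : g x <= `|x| by exact: le_trans (gp x) (tilt_le ns z x).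
have gn1 x : `|g x| <= 1 * `|x|.
  rewrite mul1r ler_norml gn andbT.
  by have := gn (- x); rewrite gN normrN; lra.
have [f f1 fg] := bounded_linear_dual gl ler01 gn1.
exists f => //; rewrite fg; apply/le_anti; rewrite gn/=.
have := le_trans (gp (- z)) (tilt_le1 ns z (- z)).
by rewrite gN (addrC (- z)) subrr normr0; lra.
Qed.

End hahn_banach.

(** * Transposes of contractions and the canonical embedding *)

Section transpose.
Context {R : realType}.

Definition contraction {Z W : normedModType R} (T : Z -> W) :=
  linear T /\ forall z, `|T z| <= `|z|.

Lemma transpose_subproof {Z W : normedModType R} {T : Z -> W} :
  contraction T -> forall g : dual W, (g \o T : Z -> R^o) \in lincont Z.
Proof.
move=> [Tl T1] g.
have gTl : linear (g \o T : Z -> R^o).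
  by move=> k x y; rewrite /= Tl linearP.
have [||f _ <-] := bounded_linear_dual (M := `|g|) gTl; last exact: dual_funP.
  exact: normr_ge0.
by move=> z; rewrite (le_trans (dual_le _ _))// ler_wpM2l.
Qed.

Definition transpose {Z W : normedModType R} {T : Z -> W}
  (Tc : contraction T) (g : dual W) : dual Z := Dual (transpose_subproof Tc g).

Lemma transpose_contraction {Z W : normedModType R} {T : Z -> W}
  (Tc : contraction T) : contraction (transpose Tc).
Proof.
split=> [k g h|g]; first exact/val_inj.
apply: sup_norm_le => // z /= z1; rewrite (le_trans (dual_le _ _))//.
by rewrite ler_piMr// (le_trans (Tc.2 z)).
Qed.

Lemma bidual_embedding_contraction (Z : normedModType R) :
  contraction (@bidual_embedding R Z).
Proof.
split=> [k x y|z]; first by apply/val_inj/funext => f /=; rewrite linearP.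
apply: sup_norm_le => // f /= f1; rewrite (le_trans (dual_le _ _))//.
by rewrite ler_piMl.
Qed.

Lemma bidual_embedding_norm {Z : normedModType R} (z : Z) :
  `|bidual_embedding z| = `|z|.
Proof.
apply/le_anti; rewrite (bidual_embedding_contraction Z).2/=.
have [f f1 fz] := norming_functional z.
rewrite -[leLHS]normr_id -fz (le_trans (dual_le (bidual_embedding z) f))//.
by rewrite ler_piMr.
Qed.

End transpose.

(** * Smoothness under contractive retractions *)

Section smooth_retract.
Context {R : realType}.

(** For [z != 0], a functional of norm at most 1 that reaches [|z|] at [z] has norm 1, so uniqueness
    extends to the unit ball. *)
Lemma smooth_point_unique {Z : normedModType R} {z : Z} {f g : dual Z} :
  smooth_point z -> `|f| <= 1 -> `|g| <= 1 -> f z = `|z| -> g z = `|z| -> f = g.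
Proof.
move=> [z0 [h [_ hu]]].
suff norm1 (k : dual Z) : `|k| <= 1 -> k z = `|z| -> `|k| = 1.
  move=> f1 g1 fz gz.
  by rewrite -(hu f (conj (norm1 _ f1 fz) fz)) (hu g (conj (norm1 _ g1 gz) gz)).
move=> k1 kz; apply/le_anti; rewrite k1/=.
have nz : 0 < `|z| by rewrite normr_gt0.
by have := dual_le k z; rewrite kz normr_id ler_pMl.
Qed.

Lemma smooth_pointP {Z : normedModType R} {z : Z} : z != 0 ->
  (forall f g : dual Z, `|f| <= 1 -> `|g| <= 1 -> f z = `|z| -> g z = `|z| ->
    f = g) -> smooth_point z.
Proof.
move=> z0 uniq; split=> //; have [f f1 fz] := norming_functional z.
have nz : 0 < `|z| by rewrite normr_gt0.
exists f; split=> [|g [g1 gz]]; last by apply: uniq => //; rewrite g1.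
split=> //; apply/le_anti; rewrite f1/=.
by have := dual_le f z; rewrite fz normr_id ler_pMl.
Qed.

Context {Z W : normedModType R} {P : Z -> W} {E : W -> Z}.
Hypotheses (Pc : contraction P) (Ec : contraction E) (EK : cancel E P).

(** Norming functionals of [P z] pull back along [P] to norming functionals of [z]; as [P] is onto,
    pulling back is injective. *)
Lemma smooth_point_retract z :
  `|P z| = `|z| -> smooth_point z -> smooth_point (P z).
Proof.
move=> Pz zs; apply: smooth_pointP => [|f g f1 g1 fz gz].
  by rewrite -normr_gt0 Pz normr_gt0; case: zs.
have fg : transpose Pc f = transpose Pc g.
  by apply: (smooth_point_unique zs);
    rewrite -?Pz ?(le_trans ((transpose_contraction Pc).2 _)).
apply/val_inj/funext => w /=; rewrite -(EK w).
exact: (congr1 (fun h : dual Z => h (E w)) fg).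
Qed.

End smooth_retract.

(** The second transposes of [P] and [E] form such a pair on the biduals, compatible with the
    canonical embeddings. *)
Lemma very_smooth_point_retract {R : realType} {Z W : normedModType R}
  {P : Z -> W} {E : W -> Z} (Pc : contraction P) (Ec : contraction E) (z : Z) :
  cancel E P -> `|P z| = `|z| -> very_smooth_point z -> very_smooth_point (P z).
Proof.
move=> EK Pz [zs zss]; split; first exact: (smooth_point_retract Pc EK).
pose P2 := transpose (transpose_contraction Pc).
pose E2 := transpose (transpose_contraction Ec).
have E2K : cancel E2 P2.
  move=> w; apply/val_inj/funext => f /=; congr (w _).
  by apply/val_inj/funext => x /=; rewrite EK.
have P2z : P2 (bidual_embedding z) = bidual_embedding (P z) by exact/val_inj.
rewrite -P2z; apply: (smooth_point_retract _ E2K) => //.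
  exact: transpose_contraction.
by rewrite P2z !bidual_embedding_norm.
Qed.

(** * Weak-star limits along ultrafilters *)

Section ultralimit.
Context {R : realType} {T : Type} (G : set_system T) {GU : UltraFilter G}.

Lemma ultra_bounded_cvg {f : T -> R} {M : R} :
  (\forall t \near G, `|f t| <= M) -> exists l : R, f @ G --> l.
Proof.
move=> fM; have [|l [_ lc]] := @segment_compact R (- M) M (f @ G) _.
  by apply: filterS fM => t /=; rewrite in_itv/= -ler_norml.
exists l => U Ul; have [//|nU] := in_ultra_setVsetC (f @^-1` U) GU.
by have [x [nUx Ux]] := lc (~` U) U nU Ul.
Qed.

(** Banach-Alaoglu in ultrafilter form: pointwise limits exist by compactness of segments, are
    linear and stay in the unit ball. *)
Lemma dual_ultralimit {W : normedModType R} {u : T -> dual W} :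
  (\forall t \near G, `|u t| <= 1) ->
  exists2 L : dual W, `|L| <= 1 & forall w, u t w @[t --> G] --> (L w : R).
Proof.
move=> u1; have uw w : \forall t \near G, `|u t w| <= `|w|.
  by apply: filterS u1 => t ut1; rewrite (le_trans (dual_le _ _))// ler_piMl.
have /choice[g gG] w := ultra_bounded_cvg (uw w).
have gl : linear (g : W -> R^o).
  move=> k x y; have := gG (k *: x + y).
  have -> : (fun t => u t (k *: x + y)) = (fun t => k * u t x + u t y) :> (T -> R).
    by apply/funext => t; rewrite linearP.
  move=> gkxy; apply: (cvg_unique (@Rhausdorff R) gkxy).
  by apply: cvgD => //; exact: cvgMl_tmp.
have g1 w : `|g w| <= 1 * `|w|.
  rewrite mul1r; have /cvg_norm := gG w => /cvgr_to_le; apply.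
  exact: uw.
have [L L1 Lg] := bounded_linear_dual gl ler01 g1.
by exists L => // w; rewrite Lg.
Qed.

End ultralimit.

Lemma dual_le1 {R : realType} {Z : normedModType R} {F : dual Z} {z : Z} :
  `|F| <= 1 -> `|z| <= 1 -> F z <= 1.
Proof.
move=> F1 z1; rewrite (le_trans (ler_norm _))// (le_trans (dual_le _ _))//.
exact: mulr_ile1.
Qed.

(** * Peak points of smooth and very smooth functions *)

Section cont_space_theory.
Context {R : realType} {Omega : topologicalType} (hO : hausdorff_space Omega).
Context {cO : compact [set: Omega]} {X : completeNormedModType R}.
Local Notation CX := (cont_space cO X).
Implicit Types (f z : CX) (t : Omega) (x : X) (F : dual CX).

Lemma cont_space_norm_le f (M : R) : 0 <= M -> (forall t, `|f t| <= M) ->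
  `|f| <= M.
Proof. by move=> M0 fM; apply: sup_norm_le. Qed.

Definition point_eval t f : X := f t.

Lemma point_eval_contraction t : contraction (point_eval t).
Proof. by split=> [//|f]; exact: cont_space_le. Qed.

Lemma continuous_fun_norm f : continuous (fun t => `|f t|).
Proof. by move=> t; apply: cvg_norm; exact: cts_fun. Qed.

Lemma norm_attained {f} : 0 < `|f| -> exists t, `|f t| = `|f|.
Proof.
move=> f0; have O0 : [set: Omega] !=set0.
  apply: contrapT => O0; move: f0; rewrite ltNge => /negP; apply.
  by apply: cont_space_norm_le => // t; case: O0; exists t.
have fc : {within [set: Omega], continuous (fun t => `|f t|)}.
  exact/continuous_subspaceT/continuous_fun_norm.
have [t _ ft] := compact_EVT_max O0 cO fc.
exists t; apply/le_anti; rewrite cont_space_le/=.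
by apply: cont_space_norm_le => // s; apply: ft; rewrite in_setT.
Qed.

(** Urysohn's lemma separates [t] from the complement of the interior of [U]; the scalar function
    then multiplies [x]. *)
Lemma bump {t U} x : nbhs t U ->
  exists h : CX, [/\ h t = x, `|h| <= `|x| & forall s, ~ U s -> h s = 0].
Proof.
move=> tU; have /normal_separatorP sep := compact_normal hO cO.
have t_closed : closed [set t].
  exact/accessible_closed_set1/hausdorff_accessible.
have Uo_closed : closed (~` U^°) by exact/open_closedC/open_interior.
have disj : ~` U^° `&` [set t] = set0.
  by rewrite -subset0 => s [/= + st]; rewrite st.
have /(uniform_separatorP (R := R))[g [gc g01 g0 g1]] :=
  sep R _ _ Uo_closed t_closed disj.
have hc : continuous (fun s => g s *: x).
  by move=> s; apply: cvgZr_tmp; exact: gc.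
pose h : CX := cts_Sub (mem_set hc).
have hE s : h s = g s *: x by [].
exists h; split=> [||s Us].
- by have gt : g t = 1 by [apply: g1; exists t]; rewrite hE gt scale1r.
- apply: cont_space_norm_le => // s; rewrite hE normrZ.
  have : `[0, 1]%classic (g s) by apply: g01; exists s.
  by rewrite /= in_itv/= => /andP[gs0 gs1]; rewrite ler_piMl// ger0_norm.
- have gs : g s = 0 by apply: g0; exists s => // /interior_subset.
  by rewrite hE gs scale0r.
Qed.

(** Were [s] and [t] distinct, norming functionals of [f s] and [f t] composed with the evaluations
    would both norm [f], yet a bump at [t] vanishing at [s] tells them apart. *)
Lemma smooth_point_peak {f s t} :
  smooth_point f -> `|f s| = `|f| -> `|f t| = `|f| -> s = t.
Proof.
move=> fs fsf ftf; apply: contrapT => st.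
have [g g1 gf] := norming_functional (f s).
have [k k1 kf] := norming_functional (f t).
have gk : transpose (point_eval_contraction s) g =
    transpose (point_eval_contraction t) k.
  apply: (smooth_point_unique fs) => /=; rewrite -?fsf -?gf//.
  - exact: le_trans ((transpose_contraction _).2 _) g1.
  - exact: le_trans ((transpose_contraction _).2 _) k1.
  - by rewrite gf fsf -ftf -kf.
have tU : nbhs t (~` [set s]).
  apply: open_nbhs_nbhs; split; last by move=> /= ts; exact: st.
  exact/closed_openC/accessible_closed_set1/hausdorff_accessible.
have [h [ht _ hs]] := bump (f t) tU.
have /eqP := congr1 (fun G : dual CX => G h) gk.
rewrite /= /point_eval ht hs; last by move=> /(_ erefl).
rewrite linear0 kf ftf eq_sym normr_eq0 => /eqP f0.
by case: fs; rewrite f0 eqxx.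
Qed.

Lemma very_smooth_point_isolated {f t} :
  `|f| = 1 -> very_smooth_point f -> `|f t| = 1 -> nbhs t [set t].
Proof.
move=> f1 [_ fs] ft; apply: contrapT => t_limit.
have /choice[x xP] s : exists g : dual X, `|g| <= 1 /\ g (f s) = `|f s|.
  by have [g g1 gf] := norming_functional (f s); exists g.
pose u s : dual CX := transpose (point_eval_contraction s) (x s).
have u1 s : `|u s| <= 1.
  exact: le_trans ((transpose_contraction _).2 _) (xP s).1.
(* As [t] is assumed not isolated, its punctured neighbourhoods form a proper filter. *)
have t_proper : ProperFilter t^'.
  split; last exact: dnbhs_filter.
  rewrite /dnbhs withinE => -[U tU U0]; apply: t_limit.
  apply: filterS tU => s Us; apply: contrapT => /eqP st.
  have : (U `&` [set s | s != t]) s by [].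
  by rewrite -U0 => -[].
have [G [GU tG]] := ultraFilterLemma t_proper.
have [|L L1 Lu] := @dual_ultralimit _ _ G _ _ (fun s => bidual_embedding (u s)).
  by apply: nearW => s; rewrite bidual_embedding_norm.
(* The value of [u s] at [f] is [|f s|], which tends to [|f t| = 1] by continuity. *)
have Lf : L (bidual_embedding f) = `|bidual_embedding f|.
  rewrite bidual_embedding_norm f1 -ft.
  apply: (cvg_unique (@Rhausdorff R) (Lu _)).
  have -> : (fun s => bidual_embedding (u s) (bidual_embedding f)) =
      (fun s => `|f s|) :> (Omega -> R).
    by apply/funext => s; rewrite /= /point_eval (xP s).2.
  move=> U /(continuous_fun_norm f t) tU.
  by apply: tG; exact: nbhs_dnbhs.
have LE : L = bidual_embedding (u t).
  apply: (smooth_point_unique fs) => //; first by rewrite bidual_embedding_norm.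
  by rewrite bidual_embedding_norm /= /point_eval (xP t).2 f1.
pose bumps (U : set Omega) :=
  [set h : CX | [/\ h t = f t, `|h| <= 1 & forall s, ~ U s -> h s = 0]].
(* The sets [bumps U] form a basis of this filter, and Urysohn's lemma makes them non-empty. *)
pose B := [set A | exists2 U, nbhs t U & bumps U `<=` A].
have B_proper : ProperFilter B.
  split.
    case=> U tU; have [h [ht h1 h0]] := bump (f t) tU.
    by move=> /(_ h); apply; split; rewrite -?ft.
  split=> [|A1 A2 [U1 tU1 UA1] [U2 tU2 UA2]|A1 A2 A12 [U tU UA1]].
  - by exists setT => //; exact: filterT.
  - exists (U1 `&` U2); first exact: filterI.
    move=> h [ht hf h0]; split; [apply: UA1|apply: UA2]; split=> // s Us;
      by apply: h0 => -[].
  - by exists U => //; exact: subset_trans A12.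
have [H [HU BH]] := ultraFilterLemma B_proper.
have [|phi _ phiP] := @dual_ultralimit _ _ H _ _ (@bidual_embedding _ CX).
  apply: BH; exists setT; first exact: filterT.
  by move=> h [_ h1 _] /=; rewrite bidual_embedding_norm.
(* The complement of [s] is a neighbourhood of [t], so along [H] the bumps eventually vanish at
   [s]. *)
have phi0 s : s != t -> phi (u s) = 0.
  move=> st; apply: (cvg_unique (@Rhausdorff R) (phiP _)).
  apply: cvg_near_cst; apply: BH; exists (~` [set s]).
    apply: open_nbhs_nbhs; split; last by move=> /= ts; rewrite ts eqxx in st.
    exact/closed_openC/accessible_closed_set1/hausdorff_accessible.
  move=> h [_ _ h0] /=.
  by rewrite /point_eval h0 ?linear0//= => /(_ erefl).
have phi1 : phi (u t) = 1.
  apply: (cvg_unique (@Rhausdorff R) (phiP _)).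
  apply: cvg_near_cst; apply: BH; exists setT; first exact: filterT.
  by move=> h [ht _ _] /=; rewrite /point_eval ht (xP t).2.
(* Along [G] one has [s != t], hence [phi (u s) = 0]; but [LE] makes [L phi] equal to
   [phi (u t) = 1]. *)
have : L phi = 0.
  apply: (cvg_unique (@Rhausdorff R) (Lu _)).
  apply: cvg_near_cst; apply: tG; apply: filterS (nbhs_dnbhs_neq t) => s.
  exact: phi0.
by rewrite LE /= phi1 => /eqP; rewrite oner_eq0.
Qed.

(** * Splitting off the value at an isolated point *)

Section isolated_point.
Context {t : Omega} (t_isolated : nbhs t [set t]).

Lemma continuous_spike x : continuous (fun s => if s == t then x else 0).
Proof.
move=> s; apply: cvg_near_cst; have [->|st] := eqVneq s t.
  by apply: filterS t_isolated => _ ->; rewrite eqxx.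
have : nbhs s (~` [set t]).
  apply: open_nbhs_nbhs; split; last by move=> /= ts; rewrite ts eqxx in st.
  exact/closed_openC/accessible_closed_set1/hausdorff_accessible.
by apply: filterS => r /eqP/negbTE ->.
Qed.

Definition spike x : CX := cts_Sub (mem_set (continuous_spike x)).

Lemma spikeE x s : spike x s = if s == t then x else 0.
Proof. by []. Qed.

Lemma spike_contraction : contraction spike.
Proof.
split=> [k x y|x].
  apply/val_inj/funext => s; rewrite -[LHS]/(spike (k *: x + y) s).
  rewrite -[RHS]/(k *: spike x s + spike y s) !spikeE.
  by case: eqP => // _; rewrite scaler0 addr0.
apply: cont_space_norm_le => // s; rewrite spikeE.
by case: eqP => // _; rewrite normr0.
Qed.

Lemma spikeK : cancel spike (point_eval t).
Proof. by move=> x; rewrite /point_eval spikeE eqxx. Qed.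

(** Since [t] is isolated, its complement is compact, and the norm of [f] has a maximum there, below
    1. *)
Lemma gap_of_peak {f} : (forall s, `|f s| = 1 -> s = t) -> `|f| = 1 ->
  exists2 r : R, 0 < r < 1 & forall s, s != t -> `|f s| <= r.
Proof.
move=> peak f1; have [t_only|/set0P Ct0] := eqVneq (~` [set t]) set0.
  exists 2^-1; first lra.
  move=> s /eqP st; have : (~` [set t]) s by [].
  by rewrite t_only.
have Cc : compact (~` [set t]).
  apply: (subclosed_compact _ cO) => //; apply: open_closedC.
  by rewrite openE => _ ->.
have fc : {within ~` [set t], continuous (fun s => `|f s|)}.
  exact/continuous_subspaceT/continuous_fun_norm.
have [c /set_mem ct fM] := compact_EVT_max Ct0 Cc fc.
have fc1 : `|f c| < 1.
  rewrite lt_neqAle -{2}f1 cont_space_le andbT.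
  by apply/eqP => /peak.
(* The midpoint between the maximum and 1 stays positive even if the maximum is 0. *)
exists ((1 + `|f c|) / 2); first by have := normr_ge0 (f c); lra.
by move=> s /eqP st; have := fM s (mem_set st); lra.
Qed.

(* Pushing [z] further away from [spike (z t)] along the same ray keeps it in
   the unit ball, so [F] cannot gain from the part of [z] off [t]. *)
Lemma state_spike {F z r} : `|F| <= 1 -> `|z| <= 1 -> 0 < r < 1 ->
  (forall s, s != t -> `|z s| <= r) -> F z = 1 -> F (spike (z t)) = 1.
Proof.
move=> F1 z1 /andP[r0 r1] zr Fz; pose y := spike (z t).
have zt1 : `|z t| <= 1 by exact: le_trans (cont_space_le _ _) z1.
have y1 : `|y| <= 1 by exact: le_trans (spike_contraction.2 _) zt1.
(* At [t] this function is [z t], elsewhere it is [r^-1 *: z s]. *)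
have w1 : `|y + r^-1 *: (z - y)| <= 1.
  apply: cont_space_norm_le => // s.
  rewrite -[X in `|X|]/(y s + r^-1 *: (z s - y s)) spikeE.
  have [->|st] := eqVneq s t; first by rewrite subrr scaler0 addr0.
  by rewrite subr0 add0r normrZ normfV gtr0_norm// ler_pdivrMl// mulr1 zr.
have := dual_le1 F1 w1; rewrite linearD linearZ linearB /= Fz.
rewrite -[_ *: _]/(r^-1 * (1 - F y)) => Fw.
have Fy := dual_le1 F1 y1.
have ri : 1 < r^-1 by rewrite invf_gt1.
apply/le_anti; rewrite Fy/= leNgt; apply/negP => Fy1.
(* [Fw] rearranges to the opposite inequality. *)
have : 0 < (r^-1 - 1) * (1 - F y) by apply: mulr_gt0; lra.
lra.
Qed.

(** If [h] in the unit ball vanishes at [t], its support is disjoint from that of [spike x], so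
    [spike x + h] stays in the ball and [F h <= 0]; the same holds for [- h]. *)
Lemma state_vanish {F x z} : `|F| <= 1 -> `|x| <= 1 -> F (spike x) = 1 ->
  z t = 0 -> F z = 0.
Proof.
move=> F1 x1 Fx zt.
have le0 (h : CX) : `|h| <= 1 -> h t = 0 -> F h <= 0.
  move=> h1 ht; have : `|spike x + h| <= 1.
    apply: cont_space_norm_le => // s.
    rewrite -[X in `|X|]/(spike x s + h s) spikeE.
    have [->|_] := eqVneq s t; first by rewrite ht addr0.
    by rewrite add0r (le_trans (cont_space_le _ _)).
  by move=> /(dual_le1 F1); rewrite linearD /= Fx; lra.
have [->|z0] := eqVneq z 0; first exact: linear0.
have nz : 0 < `|z| by rewrite normr_gt0.
pose h : CX := `|z|^-1 *: z.
have h1 : `|h| <= 1 by rewrite normrZ normfV normr_id mulVf ?gt_eqF.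
have ht : h t = 0 by rewrite -[LHS]/(`|z|^-1 *: z t) zt scaler0.
have Fh : F h = 0.
  apply/le_anti; rewrite le0//= -oppr_le0 -linearN le0 ?normrN//.
  by rewrite -[LHS]/(- h t) ht oppr0.
have -> : z = `|z| *: h by rewrite scalerA divff ?gt_eqF// scale1r.
by rewrite linearZ /= Fh scaler0.
Qed.

Lemma QP_point_of_eval {f} : `|f| = 1 -> `|f t| = 1 ->
  (forall s, `|f s| = 1 -> s = t) -> QP_point (f t) -> QP_point f.
Proof.
move=> f1 ft peak [_ [d d0 dQP]].
have [r /andP[r0 r1] fr] := gap_of_peak peak f1.
(* Half the gap: within [e] of [f], values off [t] have norm at most [r + e = (1 + r) / 2 < 1]. *)
split=> //; pose e := (1 - r) / 2.
have e0 : 0 < e by rewrite /e; lra.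
exists (Order.min d e); first by rewrite lt_min d0.
move=> z z1; rewrite lt_min => /andP[zd ze] F [F1 Fz].
pose r' := r + e; have r'01 : 0 < r' < 1 by rewrite /r' /e; lra.
have zr s : s != t -> `|z s| <= r'.
  move=> st; have := cont_space_le (z - f) s.
  rewrite -[X in `|X|]/(z s - f s) => zfs.
  have := ler_normD (z s - f s) (f s); rewrite subrK.
  by have := fr _ st; rewrite /r'; lra.
have zt : `|z t| = 1.
  have [s zs] : exists s, `|z s| = `|z| by apply: norm_attained; rewrite z1.
  have [st|/zr] := eqVneq s t; first by rewrite -st zs.
  by rewrite zs z1; lra.
have z1' : `|z| <= 1 by rewrite z1.
have Fzt := state_spike F1 z1' r'01 zr Fz.
have ztd : `|z t - f t| < d := le_lt_trans (cont_space_le (z - f) t) zd.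
(* Transposed along [spike], [F] becomes a state at [z t], hence at [f t]. *)
have [|_ Fft] := dQP (z t) zt ztd (transpose spike_contraction F).
  by split=> //; exact: le_trans ((transpose_contraction _).2 _) F1.
have ft1 : `|f t| <= 1 by rewrite ft.
(* The part of [f] off [t] is invisible to [F], so [F f = F (spike (f t)) = 1]. *)
have /(state_vanish F1 ft1 Fft) : (f - spike (f t)) t = 0.
  by rewrite -[LHS]/(f t - spike (f t) t) spikeE eqxx subrr.
rewrite linearB /= => /eqP; rewrite subr_eq0 => /eqP Ff.
by split=> //; rewrite Ff.
Qed.

End isolated_point.
End cont_space_theory.

Theorem proposition7 (R : realType) (Omega : topologicalType)
  (hO : hausdorff_space Omega) (cO : compact [set: Omega])
  (X : completeNormedModType R) :
  (forall x : X, `|x| = 1 -> very_smooth_point x -> QP_point x) ->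
  forall f : cont_space cO X, `|f| = 1 -> very_smooth_point f -> QP_point f.
Proof.
move=> XQP f f1 fvs.
have [t ft] : exists t, `|f t| = `|f| by apply: norm_attained; rewrite f1.
have ft1 : `|f t| = 1 by rewrite ft.
have t_isolated := very_smooth_point_isolated hO f1 fvs ft1.
apply: (QP_point_of_eval hO t_isolated) => // [s fs1|].
  by apply: (smooth_point_peak hO fvs.1); rewrite ?ft1 ?fs1.
apply: XQP => //.
exact: very_smooth_point_retract (point_eval_contraction t)
  (spike_contraction hO t_isolated) _ (spikeK hO t_isolated) ft fvs.
Qed.
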